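(* If $B(1.57,p)$ is true for infinitely many primes $p$, then Goppa's conjecture is false.
   Context: For an odd prime $p$ and a non-empty subset $S\subseteq GF(p)$ let $f_S(x)=\prod_{a\in S}(x-a)\in GF(p)[x]$, and let $X_S$ be the hyperelliptic curve $y^2=f_S(x)$. $|X_S(GF(p))|$ denotes the number of solutions $(x,y)\in GF(p)^2$ of $y^2=f_S(x)$ plus the number of points at infinity, which is $2$ if $|S|$ is even and $1$ if $|S|$ is odd. For a real number $c$, $B(c,p)$ is the statement: for all non-empty subsets $S\subseteq GF(p)$, $|X_S(GF(p))|\le c\cdot p$. Goppa's conjecture: the binary asymptotic Gilbert-Varshamov bound is best possible for any family of binary codes. Precisely, let $A_2(n,d)$ be the largest size of a binary code of length $n$ with minimum Hamming distance at least $d$, let $\alpha_2(\delta)=\limsup_{n\to\infty}\frac1n\log_2 A_2(n,\lceil\delta n\rceil)$, and let $H_2(\delta)=-\delta\log_2\delta-(1-\delta)\log_2(1-\delta)$. Goppa's conjecture asserts $\alpha_2(\delta)=1-H_2(\delta)$ for all $0<\delta<1/2$. *)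

(* Defs.v *)
From HB Require Import structures.
From mathcomp Require Import all_boot all_order all_algebra.
From mathcomp Require Import all_classical all_reals all_analysis.

Set Implicit Arguments.
Unset Strict Implicit.
Unset Printing Implicit Defensive.

Import Order.TTheory GRing.Theory Num.Theory.
Import numFieldNormedType.Exports.

Local Open Scope classical_set_scope.
Local Open Scope ring_scope.

(** ['F_p] is the field with [p] elements only when [p] is prime; the notions
    below that are indexed by [p] are meant for odd primes. *)

Definition hyper_poly (p : nat) (S : {set 'F_p}) : {poly 'F_p} :=
  \prod_(a in S) ('X - a%:P).

Definition affine_points (p : nat) (S : {set 'F_p}) : {set 'F_p * 'F_p} :=
  [set xy | xy.2 ^+ 2 == (hyper_poly S).[xy.1]]%SET.

Definition points_at_infinity (p : nat) (S : {set 'F_p}) : nat :=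
  if odd #|S| then 1%N else 2%N.

Definition curve_points (p : nat) (S : {set 'F_p}) : nat :=
  (#|affine_points S| + points_at_infinity S)%N.

Definition B (R : realType) (c : R) (p : nat) : Prop :=
  forall S : {set 'F_p}, S != finset.set0 -> (curve_points S)%:R <= c * p%:R.

Definition hamming_dist (n : nat) (x y : 'rV['F_2]_n) : nat :=
  #|[set i : 'I_n | x ord0 i != y ord0 i]%SET|.

(** Codes need not be linear. A code with at most one word satisfies every
    lower bound on the minimum distance. *)
Definition min_dist_ge (n d : nat) (C : {set 'rV['F_2]_n}) : bool :=
  [forall x in C, forall y in C, (x != y) ==> (d <= hamming_dist x y)%N].

Definition A2 (n d : nat) : nat :=
  \max_(C : {set 'rV['F_2]_n} | min_dist_ge d C) #|C|.

Definition log2 (R : realType) (x : R) : R := ln x / ln 2.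

(** For [0 <= delta] the ceiling is nonnegative, so the absolute value only
    converts it from [int] to [nat]. As [1 <= A2 n d <= 2 ^ n], the sequence
    takes its values in the interval from 0 to 1, so that its real-valued
    [limn_sup] is the genuine limit superior. The (irrelevant) term of index 0
    is 0. *)
Definition alpha2 (R : realType) (delta : R) : R :=
  limn_sup (fun n : nat =>
    n%:R^-1 * log2 ((A2 n `|Num.ceil (delta * n%:R)|%N)%:R : R)).

Definition H2 (R : realType) (delta : R) : R :=
  - delta * log2 delta - (1 - delta) * log2 (1 - delta).

Definition goppa_conjecture (R : realType) : Prop :=
  forall delta : R, 0 < delta < 1 / 2 -> alpha2 delta = 1 - H2 delta.

(* Main.v *)
Require Import Defs.
From mathcomp Require Import all_boot all_order all_algebra fingroup cyclic.
From mathcomp Require Import all_classical all_reals all_analysis.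
From mathcomp Require Import ring lra zify.

(** Encode a set [S] of elements of [F_p] by the [2p] parities, over [x] in
    [F_p], of the number of [a] in [S] with [x - a] a nonzero square, resp. a
    nonsquare. The word of a symmetric difference is the sum of the words, and
    for [#|S|] even the weight of the word is [2p] minus the number of affine
    points of [y^2 = f_S(x)]: if [x] is not in [S] both parities at [x] are 0
    when [f_S(x)] is a square and 1 otherwise, and if [x] is in [S] exactly one
    of them is 1. So [B(1.57, p)] makes the sets whose cardinal has a fixed
    parity into a code of length [2p] and minimum distance at least [0.43 p]
    with, for one of the two parities, at least [2^(p-1)] words. Hence
    [alpha2(1/5) >= 2/5], while [1 - H2(1/5) < 2/5] because [2^11 < 5^5]. *)

Set Implicit Arguments.
Unset Strict Implicit.
Unset Printing Implicit Defensive.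

Import Order.TTheory GRing.Theory Num.Theory.
Import numFieldNormedType.Exports.

Local Open Scope classical_set_scope.
Local Open Scope ring_scope.

(** * Squares in finite fields *)

Definition is_square (F : finFieldType) (c : F) : bool :=
  [exists y : F, y ^+ 2 == c].

Lemma is_square_sqr (F : finFieldType) (y : F) : is_square (y ^+ 2).
Proof. by apply/existsP; exists y. Qed.

Lemma finField_generator (F : finFieldType) :
  exists g : F, forall a : F, a != 0 -> exists i : nat, a = g ^+ i.
Proof.
have /cyclicP[g Eg] := field_unit_group_cyclic [set: {unit F}]%G.
exists (val g) => a nz_a.
have ua : a \is a GRing.unit by rewrite unitfE.
have : FinRing.unit F ua \in [set: {unit F}]%SET by rewrite inE.
rewrite Eg => /cycleP[i Ei]; exists i.
by rewrite -FinRing.val_unitX -Ei.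
Qed.

(** The substantial case is two nonsquares: both are odd powers of a generator of the cyclic unit
    group, so their product is an even power. *)
Lemma is_squareM (F : finFieldType) (a b : F) :
  a != 0 -> b != 0 -> is_square (a * b) = (is_square a == is_square b).
Proof.
have sqMl (c d : F) : c != 0 -> is_square c -> is_square (c * d) = is_square d.
  move=> nz_c /existsP[u /eqP Eu]; apply/existsP/existsP => -[v /eqP Ev].
    have nz_u : u != 0 by move: nz_c; rewrite -Eu expf_eq0.
    by exists (v / u); rewrite expr_div_n Ev Eu mulrAC divff // mul1r.
  by exists (u * v); rewrite exprMn Eu Ev.
move=> nz_a nz_b.
have [sqa | nsqa] := boolP (is_square a); first by rewrite sqMl.
have [sqb | nsqb] := boolP (is_square b).
  by rewrite mulrC sqMl // (negPf nsqa).
have [g gen_g] := finField_generator F.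
have odd_exp (c : F) : c != 0 -> ~~ is_square c -> exists2 i, c = g ^+ i & odd i.
  move=> nz_c; have [i ->] := gen_g c nz_c => nsq; exists i => //.
  apply: contraNT nsq => even_i.
  by rewrite -(even_halfK even_i) -muln2 exprM is_square_sqr.
have [i Ei odd_i] := odd_exp a nz_a nsqa; have [j Ej odd_j] := odd_exp b nz_b nsqb.
have even_ij : ~~ odd (i + j) by rewrite oddD odd_i odd_j.
by rewrite Ei Ej -exprD -(even_halfK even_ij) -muln2 exprM is_square_sqr.
Qed.

Lemma card_set_sum (T : finType) (S : {set T}) (P : pred T) :
  #|[set a in S | P a]%SET| = (\sum_(a in S) P a)%N.
Proof.
rewrite -sum1_card big_mkcond [RHS]big_mkcond; apply: eq_bigr => a _.
by rewrite inE; case: (a \in S); case: (P a).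
Qed.

Lemma is_square_prod (F : finFieldType) (T : finType) (S : {set T}) (g : T -> F) :
  (forall a, a \in S -> g a != 0) ->
  is_square (\prod_(a in S) g a) =
  ~~ odd #|[set a in S | ~~ is_square (g a)]%SET|.
Proof.
move=> nz_g; rewrite card_set_sum.
(* Nonvanishing of the partial product is carried through the induction because [is_squareM]
   requires it. *)
suff [] : is_square (\prod_(a in S) g a) = ~~ odd (\sum_(a in S) ~~ is_square (g a))
   /\ \prod_(a in S) g a != 0 by [].
elim/big_rec2: _ => [|a k c aS [Ec nz_c]].
  by rewrite oner_neq0 -(expr1n _ 2) is_square_sqr.
rewrite mulf_neq0 ?nz_g // is_squareM ?nz_g // Ec oddD oddb.
by case: (is_square (g a)); case: (odd k).
Qed.

Lemma card_sqrt (F : finFieldType) (c : F) : (2 : F) != 0 -> c != 0 ->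
  #|[set y : F | y ^+ 2 == c]%SET| = (2 * is_square c)%N.
Proof.
move=> nz2 nz_c; case: (boolP (is_square c)) => [/existsP[y /eqP Ey] | nsq].
  have nz_y : y != 0 by move: nz_c; rewrite -Ey expf_eq0.
  rewrite (_ : [set _ | _]%SET = [set y; - y]%SET).
    rewrite cards2 -subr_eq0 opprK -mulr2n -mulr_natr mulf_neq0 //.
  by apply/setP => z; rewrite !inE -Ey eqf_sqr.
apply/eqP; rewrite cards_eq0; apply/eqP/setP => y; rewrite !inE.
by apply: contraNF nsq => /eqP <-; exact: is_square_sqr.
Qed.

(** * The words of the code and their weights *)

Definition residue_count (F : finFieldType) (S : {set F}) (xb : F * bool) : nat :=
  #|[set a in S | (xb.1 != a) && (is_square (xb.1 - a) == xb.2)]%SET|.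

(** Both counts leave out [a = x], since [is_square 0] holds; the third summand restores it. *)
Lemma residue_countD (F : finFieldType) (S : {set F}) (x : F) :
  (residue_count S (x, true) + residue_count S (x, false) + (x \in S) = #|S|)%N.
Proof.
rewrite /residue_count !card_set_sum -(big_split _ _ (mem S)) /=.
have -> : (x \in S : nat) = (\sum_(a in S) (x == a))%N.
  rewrite -card_set_sum.
  case: (boolP (x \in S)) => xS.
    rewrite (_ : [set a in S | x == a]%SET = [set x]%SET) ?cards1 //.
    by apply/setP => a; rewrite !inE eq_sym; case: eqP => [->|]; rewrite ?xS ?andbF.
  apply/esym/eqP; rewrite cards_eq0; apply/eqP/setP => a; rewrite !inE.
  by apply/negP => /andP[aS /eqP Exa]; rewrite Exa aS in xS.
rewrite -(big_split _ _ (mem S)) /= -sum1_card; apply: eq_bigr => a _.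
by case: eqP; case: (is_square _).
Qed.

(** Additivity of the encoding modulo 2, which turns distances between words into weights. *)
Lemma odd_symdiff (T : finType) (S U : {set T}) (P : pred T) :
  odd #|[set a in [set a | (a \in S) (+) (a \in U)] | P a]%SET| =
  odd #|[set a in S | P a]%SET| (+) odd #|[set a in U | P a]%SET|.
Proof.
rewrite !card_set_sum !(big_mkcond (fun a => a \in _)) /=.
rewrite !(big_morph odd oddD (erefl : odd 0 = false)) -big_split /=.
apply: eq_bigr => a _; rewrite inE.
by case: (a \in S); case: (a \in U); case: (P a).
Qed.

Lemma Fp_odd_nz2 (p : nat) : prime p -> odd p -> (2 : 'F_p) != 0.
Proof.
move=> p_pr p_odd; apply/negP => /eqP E2.
have : 2%N \in [pchar 'F_p] by rewrite inE /= E2 eqxx.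
rewrite (pcharf_eq (pchar_Fp p_pr)) inE => /eqP E2p.
by rewrite -E2p in p_odd.
Qed.

Lemma point_residue_count (p : nat) (S : {set 'F_p}) (x : 'F_p) :
  prime p -> odd p -> ~~ odd #|S| ->
  (\sum_b odd (residue_count S (x, b)) +
   #|[set y : 'F_p | y ^+ 2 == (hyper_poly S).[x]]%SET| = 2)%N.
Proof.
move=> p_pr p_odd even_S; rewrite big_bool /=.
(* Modulo 2, as [#|S|] is even, the two parities at [x] agree if [x] is outside [S] and differ if
   [x] is in [S]. *)
have /(congr1 odd) := residue_countD S x.
rewrite !oddD oddb (negPf even_S).
have Ef : (hyper_poly S).[x] = \prod_(a in S) (x - a).
  by rewrite /hyper_poly horner_prod; apply: eq_bigr => a _; rewrite hornerXsubC.
case: (boolP (x \in S)) => xS.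
  have -> : (hyper_poly S).[x] = 0 by rewrite Ef (bigD1 x) //= subrr mul0r.
  rewrite (_ : [set _ | _]%SET = [set 0]%SET) ?cards1.
    by do 2!case: (odd _).
  by apply/setP => y; rewrite !inE expf_eq0.
have nz (a : 'F_p) : a \in S -> x - a != 0.
  by move=> aS; rewrite subr_eq0; apply: contraNneq xS => ->.
rewrite card_sqrt ?Fp_odd_nz2 // Ef; last exact/prodf_neq0.
rewrite is_square_prod //.
rewrite (_ : [set a in S | _]%SET =
  [set a in S | (x != a) && (is_square (x - a) == false)]%SET).
  by rewrite /residue_count /=; do 2!case: (odd _).
apply/setP => a; rewrite !inE; case: (boolP (a \in S)) => //= aS.
by rewrite -subr_eq0 nz // eqbF_neg.
Qed.

Lemma weight_affine_points (p : nat) (S : {set 'F_p}) :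
  prime p -> odd p -> ~~ odd #|S| ->
  (#|[set xb | odd (residue_count S xb)]%SET| + #|affine_points S| = 2 * p)%N.
Proof.
move=> p_pr p_odd even_S.
have card_pairs (T : finType) (P : 'F_p -> T -> bool) :
    #|[set xb : 'F_p * T | P xb.1 xb.2]%SET| = (\sum_x \sum_b P x b)%N.
  rewrite pair_big -sum1_card big_mkcond /=; apply: eq_bigr => xb _.
  by rewrite inE; case: (P _ _).
rewrite /affine_points (card_pairs _ (fun x y => y ^+ 2 == (hyper_poly S).[x])).
have -> : [set xb | odd (residue_count S xb)]%SET =
    [set xb : 'F_p * bool | odd (residue_count S (xb.1, xb.2))]%SET.
  by apply/setP => -[x b]; rewrite !inE.
rewrite (card_pairs _ (fun x b => odd (residue_count S (x, b)))) -big_split /=.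
rewrite (eq_bigr (fun=> 2%N)) => [|x _].
  by rewrite sum_nat_const card_Fp // mulnC.
rewrite -[RHS](point_residue_count x p_pr p_odd even_S); congr addn.
by rewrite -sum1_card [RHS]big_mkcond; apply: eq_bigr => y _; rewrite inE; case: (_ == _).
Qed.

(** * Bounds on the size of codes *)

Lemma A2_ge (I T : finType) (D : {set T}) (w : T -> I -> bool) (d : nat) :
  (0 < d)%N ->
  (forall S U, S \in D -> U \in D -> S != U ->
    (d <= #|[set i | w S i != w U i]%SET|)%N) ->
  (#|D| <= A2 #|I| d)%N.
Proof.
move=> d_gt0 dist_w.
pose f (S : T) : 'rV['F_2]_#|I| := \row_i (w S (enum_val i))%:R.
have distE S U : hamming_dist (f S) (f U) = #|[set i | w S i != w U i]%SET|.
  rewrite /hamming_dist -(card_imset _ (@enum_val_inj _ I)).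
  apply: eq_card => i; rewrite !inE; apply/imsetP/idP.
    move=> [j]; rewrite inE !mxE => ne ->; apply: contra ne => /eqP ->; exact: eqxx.
  move=> ne; exists (enum_rank i); rewrite ?enum_rankK // inE !mxE enum_rankK.
  by move: ne; case: (w S i); case: (w U i).
(* Positivity of [d] separates the words, so the image of [D] has as many elements as [D]. *)
have f_inj : {in D &, injective f}.
  move=> S U SD UD Ef; apply/eqP; apply: contraT => /(dist_w S U SD UD).
  rewrite -distE Ef /hamming_dist leqNgt (_ : [set _ | _]%SET = finset.set0) ?cards0 ?d_gt0 //.
  by apply/setP => i; rewrite !inE eqxx.
rewrite -(card_in_imset f_inj) /A2.
apply: (@bigop.leq_bigmax_cond _ (@min_dist_ge #|I| d)
  (fun C : {set 'rV['F_2]_#|I|} => #|C|) (f @: D)%SET).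
apply/forall_inP => _ /imsetP[S SD ->]; apply/forall_inP => _ /imsetP[U UD ->].
apply/implyP => ne; rewrite distE; apply: dist_w => //.
by apply: contraNneq ne => ->.
Qed.

Lemma A2_le (n d : nat) : (A2 n d <= 2 ^ n)%N.
Proof.
apply/bigmax_leqP => C _; apply: leq_trans (max_card _) _.
by rewrite card_mx card_Fp // mul1n.
Qed.

Lemma A2_residue_ge (R : realType) (p d : nat) :
  prime p -> odd p -> B (157 / 100 : R) p -> (0 < d)%N ->
  d%:R <= 43 / 100 * p%:R + 1 :> R ->
  (2 ^ p.-1 <= A2 (2 * p) d)%N.
Proof.
move=> p_pr p_odd HB d_gt0 le_d.
have class_le (b : bool) :
    (#|[set S : {set 'F_p} | odd #|S| == b]%SET| <= A2 (2 * p) d)%N.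
  have <- : #|{: 'F_p * bool}| = (2 * p)%N.
    by rewrite card_prod card_bool card_Fp // mulnC.
  apply: (@A2_ge _ _ _ (fun S xb => odd (residue_count S xb))) => // S U.
  rewrite !inE => /eqP oddS /eqP oddU neSU.
  (* The distance between the words of [S] and [U] is the weight of the word of [V], and [#|V|] is
     even because [S] and [U] lie in the same parity class. *)
  pose V := [set a | (a \in S) (+) (a \in U)]%SET.
  have even_V : ~~ odd #|V|.
    have := odd_symdiff S U predT.
    have filterT (W : {set 'F_p}) : [set a in W | predT a]%SET = W.
      by apply/setP => a; rewrite inE andbT.
    by rewrite !filterT -/V oddS oddU addbb => ->.
  have V_neq0 : V != finset.set0.
    apply: contra neSU => /eqP V0; apply/eqP/setP => a.
    by move/setP/(_ a): V0; rewrite !inE; case: (a \in S); case: (a \in U).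
  rewrite (_ : [set _ | _]%SET = [set xb | odd (residue_count V xb)]%SET); last first.
    by apply/setP => xb; rewrite !inE /residue_count odd_symdiff negb_eqb.
  have := weight_affine_points p_pr p_odd even_V.
  have := HB V V_neq0; rewrite /curve_points natrD => le_pts /(congr1 (GRing.natmul (1 : R))).
  rewrite natrD natrM -(ler_nat R) => Ew.
  (* The points at infinity pay for the [+ 1] in the bound on [d], which later absorbs the rounding
     of the ceiling. *)
  have : 1 <= (points_at_infinity V)%:R :> R.
    by rewrite /points_at_infinity; case: ifP; rewrite ?ler1n.
  lra.
(* Pigeonhole: the two parity classes together contain all [2 ^ p] subsets. *)
have /(congr1 (fun S : {set {set 'F_p}} => #|S|)) :
    ([set S : {set 'F_p} | odd #|S| == true] :|:
     [set S : {set 'F_p} | odd #|S| == false])%SET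
    = [set: {set 'F_p}]%SET.
  by apply/setP => S; rewrite !inE; case: (odd _).
rewrite -powersetT card_powerset cardsT card_Fp // => Ecard.
have := leq_card_setU [set S : {set 'F_p} | odd #|S| == true]%SET
  [set S : {set 'F_p} | odd #|S| == false]%SET.
move=> [+ _]; rewrite Ecard.
have -> : (2 ^ p = 2 * 2 ^ p.-1)%N by rewrite -expnS prednK ?prime_gt0.
have := class_le true; have := class_le false; lia.
Qed.

(** * Rates, entropy and the conclusion *)

Lemma limn_sup_ge (R : realType) (u : nat -> R) (c : R) :
  (forall n, 0 <= u n <= 1) ->
  (forall N, exists2 n, (N <= n)%N & c <= u n) -> c <= limn_sup u.
Proof.
move=> u01 c_often.
(* Boundedness makes the tail suprema genuine and convergent; each of them is at least [c]. *)
have ub_u : has_ubound (range u) by exists 1 => _ [n _ <-]; case/andP: (u01 n).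
have lb_u : has_lbound (range u) by exists 0 => _ [n _ <-]; case/andP: (u01 n).
apply: limr_ge; first by apply/cvg_ex; eexists; exact: cvg_sups_inf.
apply: nearW => N; have [n leNn le_c] := c_often N.
apply: le_trans le_c _; apply: ub_le_sup; first exact: has_ubound_sdrop.
by exists n.
Qed.

Lemma log2_X2 (R : realType) (n : nat) : log2 ((2 : R) ^+ n) = n%:R.
Proof.
have ln2 : 0 < ln (2 : R) by rewrite ln_gt0 ?ltr1n.
by rewrite /log2 lnXn // -[_ *+ n]mulr_natl mulfK ?gt_eqF.
Qed.

Lemma ler_log2 (R : realType) (x y : R) : 0 < x -> x <= y -> log2 x <= log2 y.
Proof.
move=> x_gt0 le_xy; rewrite /log2 ler_wpM2r ?invr_ge0 ?ln_ge0 ?ler1n //.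
by rewrite ler_ln // posrE ?(lt_le_trans x_gt0).
Qed.

Lemma A2_rate_bound (R : realType) (n d : nat) :
  0 <= n%:R^-1 * log2 ((A2 n d)%:R : R) <= 1.
Proof.
(* The degenerate cases use the conventions [ln 0 = 0] and, for [n = 0], [0^-1 = 0]. *)
have [-> | A_gt0] := posnP (A2 n d).
  by rewrite /log2 ln0 // mul0r mulr0 lexx ler01.
have [-> | n_gt0] := posnP n; first by rewrite invr0 mul0r lexx ler01.
rewrite mulr_ge0 ?invr_ge0 ?ler0n //=; last first.
  by rewrite /log2 divr_ge0 // ln_ge0 ?ler1n.
rewrite ler_pdivrMl ?ltr0n // mulr1 -[leRHS]log2_X2 ler_log2 ?ltr0n //.
by rewrite -natrX ler_nat A2_le.
Qed.

(** Since [H2 (1 / 5) = log2 5 - 8 / 5], the claim says that [log2 5] exceeds [11 / 5]. *)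
Lemma H2_fifth (R : realType) : 3 / 5 < H2 (1 / 5 : R).
Proof.
have ln2 : 0 < ln (2 : R) by rewrite ln_gt0 ?ltr1n.
have ln54 : ln (4 : R) = 2 * ln 2.
  by rewrite (_ : 4 = 2 ^+ 2) ?lnXn ?mulr_natl //; ring.
have E : H2 (1 / 5 : R) = ln 5 / ln 2 - 8 / 5.
  rewrite /H2 /log2 (_ : 1 - 1 / 5 = 4 / 5 :> R); last by field.
  by rewrite !ln_div ?posrE // ln1 ln54; field; rewrite gt_eqF.
have : ln ((2 : R) ^+ 11) < ln (5 ^+ 5).
  by rewrite ltr_ln ?posrE ?exprn_gt0 // -!natrX ltr_nat.
rewrite !lnXn // -[ln 2 *+ _]mulr_natl -[ln 5 *+ _]mulr_natl => lt_ln.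
rewrite E ltrBrDr ltr_pdivlMr //; lra.
Qed.

Theorem theorem5 (R : realType)
    (HB : infinite_set [set p : nat | prime p /\ odd p /\ B (157 / 100 : R) p]) :
  ~ goppa_conjecture R.
Proof.
move=> /(_ (1 / 5)) goppa.
have := H2_fifth R.
suff : 2 / 5 <= alpha2 (1 / 5 : R) by rewrite goppa; lra.
apply: limn_sup_ge => [n|N]; first exact: A2_rate_bound.
(* Besides [N <= 2p], the choice of [p] ensures [5 <= p], which is exactly what
   [2 / 5 <= (p - 1) / (2p)] requires at the end. *)
have [p [[p_pr [p_odd Bp]] /= lep]] :=
  infinite_setN0 (infinite_setD HB (finite_II (N + 5))).
have {lep} leNp : (N + 5 <= p)%N by rewrite leqNgt; apply/negP.
exists (2 * p)%N; first by lia.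
have p_ge5 : 5 <= p%:R :> R by rewrite ler_nat; lia.
set d := `|_|%N.
have dE : (d%:R : R) = (Num.ceil (1 / 5 * (2 * p)%:R : R))%:~R.
  by rewrite /d natr_absz ger0_norm // ceil_ge0 (lt_le_trans (ltrN10 _)) // natrM; lra.
have d_ge : 1 / 5 * (2 * p)%:R <= d%:R :> R by rewrite dE ceil_ge.
have d_lt : d%:R < 1 / 5 * (2 * p)%:R + 1 :> R.
  by rewrite dE; have /andP[] := ceil_itv (1 / 5 * (2 * p)%:R : R); rewrite intrB; lra.
rewrite natrM in d_ge d_lt *.
have d_gt0 : (0 < d)%N by rewrite -(ltr_nat R); lra.
(* The ceiling [d] of [2p / 5] is below [0.4p + 1], hence within the allowed [0.43p + 1]. *)
have A_ge : (2 ^ p.-1 <= A2 (2 * p) d)%N by apply: A2_residue_ge Bp _ _ => //; lra.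
rewrite ler_pdivlMl; last lra.
apply: (@le_trans _ _ (log2 ((2 ^ p.-1)%:R : R))); last first.
  by rewrite ler_log2 ?ltr0n ?expn_gt0 ?ler_nat.
rewrite natrX log2_X2.
have : p%:R = p.-1%:R + 1 :> R by rewrite natr1 prednK ?prime_gt0.
lra.
Qed.
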